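(* Let $R$ be a Noetherian ring of dimension $d$ and let $M$ be an $R$-module. Suppose that $\operatorname{Ass}_R M_f$ is finite for every non-unit $f\in R$. Then $\operatorname{Ass}_R M$ is finite. In particular (for $i\ge 0$), if $\operatorname{Ass}_R H^i_I(R_f)$ is finite for every non-unit $f\in R$ and every ideal $I\subset R$, then $\operatorname{Ass}_R H^i_I(R)$ is finite for every ideal $I\subset R$.
   Context: All rings are commutative with unity. $M_f$ denotes the localization of $M$ at the multiplicative set $\{1,f,f^2,\ldots\}$, regarded as an $R$-module. $H^i_I(-)$ denotes the $i$-th local cohomology module with support in the ideal $I$. *)

(* Defs.v *)
From HB Require Import structures.
From mathcomp Require Import all_boot all_order all_algebra.
From mathcomp Require Import all_classical zify.

Set Implicit Arguments.
Unset Strict Implicit.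
Unset Printing Implicit Defensive.

Import Order.TTheory GRing.Theory Num.Theory.
Local Open Scope classical_set_scope.
Local Open Scope ring_scope.
Local Open Scope quotient_scope.

Section CommutativeAlgebra.
Variable R : comPzRingType.

Definition invertible (f : R) : Prop := exists g : R, f * g = 1.

Definition is_ideal (I : set R) : Prop :=
  [/\ I 0, forall x y, I x -> I y -> I (x + y) & forall a x, I x -> I (a * x)].

Definition prime_ideal (P : set R) : Prop :=
  [/\ is_ideal P, ~ P 1 & forall a b, P (a * b) -> P a \/ P b].

Definition ideal_span n (a : 'I_n -> R) : set R :=
  [set x | exists r : 'I_n -> R, x = \sum_(i < n) r i * a i].

Definition noetherian : Prop :=
  forall I : set R, is_ideal I ->
    exists n, exists a : 'I_n -> R, I = ideal_span a.

Definition prime_chain (n : nat) : Prop :=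
  exists P : nat -> set R,
    (forall i, (i <= n)%N -> prime_ideal (P i)) /\
    (forall i, (i < n)%N -> P i `<` P i.+1).

(* In particular the zero ring has no Krull dimension in [nat]. *)
Definition krull_dim (d : nat) : Prop :=
  forall n, prime_chain n <-> (n <= d)%N.

Definition ideal_mul (I J : set R) : set R :=
  [set x | exists n, exists a b : 'I_n -> R,
     (forall i, I (a i) /\ J (b i)) /\ x = \sum_(i < n) a i * b i].

Fixpoint ideal_pow (I : set R) (n : nat) : set R :=
  if n is n'.+1 then ideal_mul I (ideal_pow I n') else setT.

Definition Ass (M : lmodType R) : set (set R) :=
  [set P | prime_ideal P /\ exists m : M, P = [set a | a *: m = 0]].

End CommutativeAlgebra.

Section Localization.
Variables (R : comPzRingType) (M : lmodType R) (f : R).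
Implicit Types u v : M * nat.

(* The pair [(m, a)] stands for the fraction [m / f ^+ a]. *)
Definition loc_equiv u v : bool :=
  `[< exists k, f ^+ (k + v.2) *: u.1 = f ^+ (k + u.2) *: v.1 >].

Lemma loc_equiv_is_equiv : equiv_class_of loc_equiv.
Proof.
split=> [u|u v|v u w].
- by apply/asboolP; exists 0%N.
- by apply/asboolP/asboolP => -[k e]; exists k.
- move=> /asboolP[k e] /asboolP[l e']; apply/asboolP.
  exists (k + l + v.2)%N.
  have := congr1 (fun x => f ^+ (l + w.2) *: x) e.
  have := congr1 (fun x => f ^+ (k + u.2) *: x) e'.
  rewrite !scalerA -!exprD => e1 e2.
  have -> : (k + l + v.2 + w.2 = l + w.2 + (k + v.2))%N by lia.
  rewrite e2; have -> : (l + w.2 + (k + u.2) = k + u.2 + (l + w.2))%N by lia.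
  by rewrite e1; congr (f ^+ _ *: _); lia.
Qed.

Canonical loc_equiv_equiv := EquivRelPack loc_equiv_is_equiv.
Canonical loc_equiv_encModRel := defaultEncModRel loc_equiv.

Definition localization := {eq_quot loc_equiv}.

HB.instance Definition _ : EqQuotient _ loc_equiv localization :=
  EqQuotient.on localization.
HB.instance Definition _ := Choice.on localization.

Definition frac (m : M) (a : nat) : localization :=
  (\pi_localization (m, a))%qT.

Lemma fracP m a n b :
  frac m a = frac n b <-> exists k, f ^+ (k + b) *: m = f ^+ (k + a) *: n.
Proof.
rewrite /frac; split=> [/eqP|h]; last by apply/eqP; rewrite piE; apply/asboolP.
by rewrite piE => /asboolP.
Qed.

Lemma frac_ind (P : localization -> Prop) :
  (forall m a, P (frac m a)) -> forall x, P x.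
Proof. by move=> h x; rewrite -[x]reprK; case: (repr x) => m a; exact: h. Qed.

Definition loc_zero : localization := frac 0 0.
Definition loc_opp (x : localization) : localization :=
  frac (- (repr x).1) (repr x).2.
Definition loc_add (x y : localization) : localization :=
  frac (f ^+ (repr y).2 *: (repr x).1 + f ^+ (repr x).2 *: (repr y).1)
       ((repr x).2 + (repr y).2).
Definition loc_scale (r : R) (x : localization) : localization :=
  frac (r *: (repr x).1) (repr x).2.

Lemma repr_frac m a :
  exists k, f ^+ (k + a) *: (repr (frac m a)).1 =
            f ^+ (k + (repr (frac m a)).2) *: m.
Proof.
apply/fracP; rewrite /frac.
by rewrite -[RHS]reprK; congr (\pi _)%qT; rewrite -surjective_pairing.
Qed.

Lemma loc_oppE m a : loc_opp (frac m a) = frac (- m) a.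
Proof.
have [k e] := repr_frac m a; apply/fracP; exists k.
by rewrite !scalerN e.
Qed.

Lemma loc_scaleE r m a : loc_scale r (frac m a) = frac (r *: m) a.
Proof.
have [k e] := repr_frac m a; apply/fracP; exists k.
by rewrite !scalerA ![_ * r]mulrC -!scalerA e.
Qed.

Lemma loc_addE m a n b :
  loc_add (frac m a) (frac n b) = frac (f ^+ b *: m + f ^+ a *: n) (a + b).
Proof.
rewrite /loc_add; have [k] := repr_frac m a; have [l] := repr_frac n b.
case: (repr (frac m a)) (repr (frac n b)) => [m' a'] [n' b'] /= e' e.
apply/fracP; exists (k + l)%N; rewrite !scalerDr !scalerA -!exprD.
have -> : (k + l + (a + b) + b' = l + b + b' + (k + a))%N by lia.
have -> : (k + l + (a + b) + a' = k + a + a' + (l + b))%N by lia.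
rewrite exprD -scalerA e [f ^+ (_ + (l + b))]exprD -scalerA e' !scalerA -!exprD.
by congr (f ^+ _ *: _ + f ^+ _ *: _); lia.
Qed.

Lemma loc_addA : associative loc_add.
Proof.
elim/frac_ind=> m a; elim/frac_ind=> n b; elim/frac_ind=> p c.
rewrite !loc_addE addnA !scalerDr !scalerA -!exprD addrA.
by rewrite (addnC c b) (addnC c a).
Qed.

Lemma loc_addC : commutative loc_add.
Proof.
elim/frac_ind=> m a; elim/frac_ind=> n b.
by rewrite !loc_addE addnC addrC.
Qed.

Lemma loc_add0 : left_id loc_zero loc_add.
Proof.
by elim/frac_ind=> m a; rewrite loc_addE scaler0 add0r expr0 scale1r add0n.
Qed.

Lemma loc_addN : left_inverse loc_zero loc_opp loc_add.
Proof.
elim/frac_ind=> m a; rewrite loc_oppE loc_addE scalerN addNr.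
by apply/fracP; exists 0%N; rewrite !scaler0.
Qed.

HB.instance Definition _ :=
  GRing.isZmodule.Build localization loc_addA loc_addC loc_add0 loc_addN.

Lemma loc_scaleA r s x : loc_scale r (loc_scale s x) = loc_scale (r * s) x.
Proof. by elim/frac_ind: x => m a; rewrite !loc_scaleE scalerA. Qed.

Lemma loc_scale1 : left_id 1 loc_scale.
Proof. by elim/frac_ind=> m a; rewrite loc_scaleE scale1r. Qed.

Lemma loc_scaleDr : right_distributive loc_scale +%R.
Proof.
move=> r; elim/frac_ind=> m a; elim/frac_ind=> n b.
rewrite [frac m a + _]loc_addE !loc_scaleE [RHS]loc_addE.
by rewrite scalerDr !scalerA ![r * _]mulrC.
Qed.

Lemma loc_scaleDl x : {morph loc_scale^~ x : r s / r + s}.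
Proof.
elim/frac_ind: x => m a r s; rewrite !loc_scaleE [RHS]loc_addE.
apply/fracP; exists 0%N.
by rewrite !add0n -scalerDr -scalerDl exprD -scalerA.
Qed.

HB.instance Definition _ := GRing.Zmodule_isLmodule.Build R localization
  loc_scaleA loc_scale1 loc_scaleDr loc_scaleDl.

End Localization.

Section QuotientModule.
Variables (R : comPzRingType) (M : lmodType R) (N : submodClosed M).

(* [submodClosed] does not inherit from [zmodClosed], which [Quotient.quot]
   expects. *)
Definition submod_pred : {pred M} := fun x => x \in N.

Lemma submod_pred_zmod_closed : zmod_closed submod_pred.
Proof.
have inN x : (x \in submod_pred) = (x \in N) by [].
split=> [|x y]; rewrite !inN ?rpred0 // => hx hy.
by rewrite rpredD // -scaleN1r rpredZ.
Qed.

HB.instance Definition _ :=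
  GRing.isZmodClosed.Build M submod_pred submod_pred_zmod_closed.

Definition quotient_module := Quotient.quot submod_pred.

HB.instance Definition _ := GRing.Zmodule.on quotient_module.

Definition quo (x : M) : quotient_module := (\pi_(Quotient.quot submod_pred) x)%qT.

Lemma quoE x y : quo x = quo y <-> x - y \in N.
Proof.
rewrite -[_ \in N]/(x - y \in submod_pred) Quotient.idealrBE.
by split=> [/eqP|h]; last exact/eqP.
Qed.

Lemma quo_ind (P : quotient_module -> Prop) : (forall x, P (quo x)) -> forall y, P y.
Proof. by move=> h y; rewrite -[y]reprK; exact: h. Qed.

Lemma quoD x y : quo (x + y) = quo x + quo y.
Proof. by rewrite /quo [LHS]raddfD. Qed.

Definition quo_scale (r : R) (y : quotient_module) : quotient_module := quo (r *: repr y).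

Lemma quo_scaleE r x : quo_scale r (quo x) = quo (r *: x).
Proof.
apply/quoE; rewrite -scalerBr rpredZ //; apply/quoE.
by rewrite /quo reprK.
Qed.

Lemma quo_scaleA r s y : quo_scale r (quo_scale s y) = quo_scale (r * s) y.
Proof. by elim/quo_ind: y => x; rewrite !quo_scaleE scalerA. Qed.

Lemma quo_scale1 : left_id 1 quo_scale.
Proof. by elim/quo_ind=> x; rewrite quo_scaleE scale1r. Qed.

Lemma quo_scaleDr : right_distributive quo_scale +%R.
Proof.
move=> r; elim/quo_ind=> x; elim/quo_ind=> y.
by rewrite -quoD !quo_scaleE scalerDr quoD.
Qed.

Lemma quo_scaleDl y : {morph quo_scale^~ y : r s / r + s}.
Proof. by elim/quo_ind: y => x r s; rewrite !quo_scaleE scalerDl quoD. Qed.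

HB.instance Definition _ := GRing.Zmodule_isLmodule.Build R quotient_module
  quo_scaleA quo_scale1 quo_scaleDr quo_scaleDl.

Lemma quo_is_linear : linear quo.
Proof. by move=> r x y; rewrite quoD -quo_scaleE. Qed.

HB.instance Definition _ := GRing.isLinear.Build R M quotient_module _ quo quo_is_linear.

End QuotientModule.

Section Cohomology.
Variables (R : comPzRingType) (C : nat -> lmodType R).
Variable d : forall n, {linear C n -> C n.+1}.

Definition cocycle n : {pred C n} := fun x => d n x == 0.

Lemma cocycle_closed n : GRing.submod_closed (@cocycle n).
Proof.
split=> [|r x y]; rewrite !unfold_in ?linear0 // => /eqP dx /eqP dy.
by rewrite linearP dx dy scaler0 addr0.
Qed.

HB.instance Definition _ n :=
  GRing.isSubmodClosed.Build R (C n) (@cocycle n) (cocycle_closed n).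

Definition cocycles n := {x : C n | x \in @cocycle n}.

HB.instance Definition _ n := SubType.on (cocycles n).
HB.instance Definition _ n := Choice.on (cocycles n).
HB.instance Definition _ n := [SubChoice_isSubLmodule of cocycles n by <:].

(* [C] starts in degree 0, hence nothing but 0 is a coboundary there. *)
Definition coboundary n : set (C n) :=
  match n with
  | 0 => [set 0]
  | m.+1 => range (d m)
  end.

Definition coboundary_in n : {pred cocycles n} :=
  fun z => `[< coboundary (val z) >].

Lemma coboundary_in_closed n : GRing.submod_closed (@coboundary_in n).
Proof.
split=> [|r x y].
  by apply/asboolP; case: n => [|n] //=; exists 0 => //; rewrite linear0.
move=> /asboolP hx /asboolP hy; apply/asboolP.
rewrite linearP /=; case: n x y hx hy => [|n] x y /=.
  by move=> -> ->; rewrite scaler0 addr0.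
by move=> [u _ <-] [v _ <-]; exists (r *: u + v); rewrite ?linearP.
Qed.

HB.instance Definition _ n := GRing.isSubmodClosed.Build R (cocycles n)
  (@coboundary_in n) (coboundary_in_closed n).

(* The relation [d n.+1 (d n x) = 0] is not part of the data: the definition
   reads Z^n / (Z^n :&: B^n), which is Z^n / B^n for a complex. *)
Definition cohomology n : lmodType R := quotient_module (@coboundary_in n).

End Cohomology.

Section Torsion.
Variables (R : comPzRingType) (I : set R).

(* Union over [n] of the submodules killed by [I ^ n]. *)
Definition torsion (M : lmodType R) : {pred M} :=
  fun x => `[< exists n, forall a, ideal_pow I n a -> a *: x = 0 >].
Arguments torsion : clear implicits.

Lemma ideal_pow_mulr n a r : ideal_pow I n a -> ideal_pow I n (r * a).
Proof.
elim: n a => [//|n IHn] a [m [b [c [h ->]]]].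
exists m, b, (fun i => r * c i); split=> [i|].
  by have [hb hc] := h i; split=> //; exact: IHn.
by rewrite mulr_sumr; apply: eq_bigr => i _; rewrite mulrCA.
Qed.

Lemma ideal_pow_add n a b :
  ideal_pow I n a -> ideal_pow I n b -> ideal_pow I n (a + b).
Proof.
case: n => [//|n] [m [a1 [a2 [ha ->]]]] [p [b1 [b2 [hb ->]]]].
exists (m + p)%N.
exists (fun i => match fintype.split i with inl j => a1 j | inr j => b1 j end).
exists (fun i => match fintype.split i with inl j => a2 j | inr j => b2 j end).
split=> [i|]; first by case: (fintype.split i) => j; [exact: ha | exact: hb].
rewrite big_split_ord /=; congr (_ + _); apply: eq_bigr => i _.
  by have /= -> := unsplitK (inl i : 'I_m + 'I_p).
by have /= -> := unsplitK (inr i : 'I_m + 'I_p).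
Qed.

Lemma ideal_pow0 n : ideal_pow I n 0.
Proof.
case: n => // n; exists 0%N, (fun=> 0), (fun=> 0).
by split=> [[]//|]; rewrite big_ord0.
Qed.

Lemma ideal_powS n a : ideal_pow I n.+1 a -> ideal_pow I n a.
Proof.
move=> [m [b [c [h ->]]]]; elim/big_ind: _ => [|x y|i _].
- exact: ideal_pow0.
- exact: ideal_pow_add.
- by apply: ideal_pow_mulr; case: (h i).
Qed.

Lemma ideal_pow_le m n a : (m <= n)%N -> ideal_pow I n a -> ideal_pow I m a.
Proof.
move=> /subnK <-; elim: (n - m)%N => [//|k IHk].
by rewrite addSn => /ideal_powS.
Qed.

Lemma torsion_closed M : GRing.submod_closed (torsion M).
Proof.
split=> [|r x y]; first by apply/asboolP; exists 0%N => a _; rewrite scaler0.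
move=> /asboolP[m hx] /asboolP[n hy]; apply/asboolP; exists (maxn m n) => a ha.
rewrite scalerDr scalerA mulrC -scalerA.
rewrite hx ?hy ?scaler0 ?addr0 //; apply: ideal_pow_le ha.
  exact: leq_maxr.
exact: leq_maxl.
Qed.

HB.instance Definition _ M :=
  GRing.isSubmodClosed.Build R M (torsion M) (torsion_closed M).

Definition Gamma (M : lmodType R) := {x : M | x \in torsion M}.

HB.instance Definition _ M := SubType.on (Gamma M).
HB.instance Definition _ M := Choice.on (Gamma M).
HB.instance Definition _ M := [SubChoice_isSubLmodule of Gamma M by <:].

Section GammaMap.
Variables (M N : lmodType R) (u : {linear M -> N}).

Lemma Gamma_map_subproof (x : Gamma M) : u (val x) \in torsion N.
Proof.
apply/asboolP; have /asboolP[n h] := valP x.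
by exists n => a ha; rewrite -linearZ h // linear0.
Qed.

Definition Gamma_map (x : Gamma M) : Gamma N :=
  exist _ (u (val x)) (Gamma_map_subproof x).

Lemma Gamma_map_is_linear : linear Gamma_map.
Proof. by move=> r x y; apply: val_inj; rewrite [RHS]linearP /= !linearP. Qed.

HB.instance Definition _ :=
  GRing.isLinear.Build R (Gamma M) (Gamma N) _ Gamma_map Gamma_map_is_linear.

End GammaMap.
End Torsion.

Arguments Gamma {R} I M.
Arguments Gamma_map {R} I {M N} u x.

Section InjectiveModules.
Variable R : comPzRingType.

Definition injective_module (E : lmodType R) : Prop :=
  forall (A B : lmodType R) (i : {linear A -> B}) (g : {linear A -> E}),
    injective i -> exists h : {linear B -> E}, forall a, h (i a) = g a.

Record injective_resolution (M : lmodType R) := InjectiveResolution {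
  res_obj : nat -> lmodType R;
  res_diff : forall n, {linear res_obj n -> res_obj n.+1};
  res_aug : {linear M -> res_obj 0%N};
  res_injective : forall n, injective_module (res_obj n);
  res_aug_inj : injective res_aug;
  res_exact0 : forall x, res_diff 0 x = 0 <-> range res_aug x;
  res_exactS : forall n x, res_diff n.+1 x = 0 <-> range (res_diff n) x }.

End InjectiveModules.

Section Divisible.
Variables (B D : zmodType).
Hypothesis D_div : forall n (y : D), (0 < n)%N -> exists z, z *+ n = y.

(* The graph of an additive map from a subgroup of [B] to [D]. *)
Definition partial_additive (G : set (B * D)) : Prop :=
  [/\ G (0, 0), forall u v, G u -> G v -> G (u - v) & forall y, G (0, y) -> y = 0].

Section Closure.
Variables (G : set (B * D)) (hG : partial_additive G).

Lemma partial_additive_opp u : G u -> G (- u).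
Proof. by case: hG => G0 GB _ Gu; rewrite -[- u]add0r; exact: GB. Qed.

Lemma partial_additive_add u v : G u -> G v -> G (u + v).
Proof.
case: hG => G0 GB _ Gu Gv; rewrite -[v]opprK; apply: GB => //.
exact: partial_additive_opp.
Qed.

Lemma partial_additive_muln u n : G u -> G (u *+ n).
Proof.
move=> Gu; elim: n => [|n IHn]; first by case: hG.
by rewrite mulrS; exact: partial_additive_add.
Qed.

Lemma partial_additive_mulz u n : G u -> G (u *~ n).
Proof.
move=> Gu; case: n => n; first exact: partial_additive_muln.
by rewrite NegzE mulrNz; apply/partial_additive_opp/partial_additive_muln.
Qed.

Lemma partial_additive_fun b y z : G (b, y) -> G (b, z) -> y = z.
Proof.
case: hG => G0 GB Gf h1 h2; apply/subr0_eq/Gf.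
by have := GB _ _ h1 h2; rewrite -[_ - _]/(b - b, y - z) subrr.
Qed.

Lemma pair_mulz (b : B) (y : D) n : (b, y) *~ n = (b *~ n, y *~ n).
Proof.
have E m : (b, y) *+ m = (b *+ m, y *+ m).
  by elim: m => // m IH; rewrite !mulrS IH.
by case: n => n; rewrite ?NegzE ?mulrNz -!pmulrn E.
Qed.

Lemma partial_additive_value b :
  exists z, forall n y, G (b *~ n, y) -> y = z *~ n.
Proof.
pose S n := `[< (0 < n)%N /\ exists y, G (b *+ n, y) >].
have [[n0 Sn0]|noS] := pselect (exists n, S n); last first.
  exists 0 => -[n|n] y hy; rewrite mul0rz.
    case: n hy => [|n] hy; first by case: hG => _ _; apply; move: hy; rewrite mulr0z.
    by case: noS; exists n.+1; apply/asboolP; split=> //; exists y.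
  case: noS; exists n.+1; apply/asboolP; split=> //; exists (- y).
  by have := partial_additive_opp hy; rewrite NegzE mulrNz -[- (_, _)]/(_, _) opprK.
have exS : exists n, S n by exists n0.
case: (ex_minnP exS) => m /asboolP[m0 [w hw]] min {n0 Sn0 exS}.
have [z ez] := D_div w m0; exists z => n y hy.
have m0' : (m%:Z != 0) by rewrite eqz_nat -lt0n.
have := divz_eq n m; set q := (n %/ m)%Z => en.
have hr : G (b *~ (n %% m)%Z, y - w *~ q).
  have := partial_additive_add hy (partial_additive_opp (partial_additive_mulz q hw)).
  rewrite pair_mulz -[X in G X]/(_ - _, _ - _) {1}en mulrzDr.
  by rewrite -[b *+ m]/(b *~ m) -mulrzA [(m%:Z * q)]mulrC addrAC subrr add0r.
have := ltz_pmod n (m0 : (0 < m%:Z)); have := modz_ge0 n m0'.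
move: hr en; case: (n %% m)%Z => // -[|r] hr en _ rm.
  rewrite mulr0z in hr; case: hG => _ _ /(_ _ hr)/subr0_eq ->.
  by rewrite en addr0 -ez mulrC mulrzA -pmulrn.
have /min : S r.+1 by apply/asboolP; split=> //; eexists; exact: hr.
by rewrite leqNgt -ltz_nat rm.
Qed.

Lemma partial_additive_extend b z :
  (forall n y, G (b *~ n, y) -> y = z *~ n) ->
  partial_additive
    [set u | exists v, exists n : int, G v /\ u = v + (b *~ n, z *~ n)].
Proof.
move=> hz; split.
- by exists (0, 0), 0; split; [case: hG | rewrite !mulr0z addr0].
- move=> _ _ [u [n [Gu ->]]] [v [m [Gv ->]]]; exists (u - v), (n - m).
  split; first by case: hG => _ GB _; exact: GB.
  by rewrite -!pair_mulz mulrzBr opprD addrACA.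
- move=> y [[a c] [n [Gac /pair_equal_spec[/esym/eqP]]]] /=.
  rewrite addr_eq0 => /eqP ea ->.
  have := hz (- n) c; rewrite mulrNz -ea => /(_ Gac) ->.
  by rewrite mulrNz addNr.
Qed.

End Closure.

Lemma additive_extension (G : set (B * D)) : partial_additive G ->
  exists h : {additive B -> D}, forall b y, G (b, y) -> h b = y.
Proof.
move=> hG.
have [F FP Ftot|A [hA Amax]] :=
  @Zorn_bigcup _ (fun X => partial_additive (X `|` G)).
  pose U := \bigcup_(X in F) X `|` G.
  have sub u v : U u -> U v ->
      exists H, [/\ partial_additive H, H `<=` U, H u & H v].
    have FU X : F X -> X `|` G `<=` U.
      by move=> FX w [Xw|Gw]; [left; exists X | right].
    move=> [[X FX Xu]|Gu] [[Y FY Yv]|Gv].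
    - have [XY|YX] := Ftot X Y FX FY.
        by exists (Y `|` G); split; [exact: FP|exact: FU|left; exact: XY|left].
      by exists (X `|` G); split; [exact: FP|exact: FU|left|left; exact: YX].
    - by exists (X `|` G); split; [exact: FP|exact: FU|left|right].
    - by exists (Y `|` G); split; [exact: FP|exact: FU|right|left].
    - by exists G; split=> // w Gw; right.
  split; first by right; case: hG.
  - by move=> u v /sub/[apply] -[H [[_ HB _] HU Hu Hv]]; exact/HU/HB.
  - move=> y Uy; have [H [[_ _ Hf] _ Hy _]] := sub _ _ Uy Uy; exact: Hf.
set H := A `|` G in hA.
have tot b : exists y, H (b, y).
  apply: contrapT => nHb.
  have [z hz] := partial_additive_value hA b.
  have hH' := partial_additive_extend hA hz.
  set H' := [set u | _] in hH'.
  have HH' : H `<=` H'.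
    by move=> u Hu; exists u, 0; rewrite !mulr0z addr0.
  apply: (Amax H'); last first.
    by rewrite (_ : H' `|` G = H') //; apply: setUidl => u Gu; apply: HH'; right.
  split=> [u Au|H'A]; first by apply: HH'; left.
  apply: nHb; exists z; left; apply: H'A.
  by exists (0, 0), 1; split; [case: hA | rewrite !mulr1z add0r].
have [h hH] := choice tot.
have hB : zmod_morphism h.
  move=> b c; apply: (partial_additive_fun hA (hH _)).
  by case: hA => _ HB _; exact: (HB (b, h b) (c, h c)).
pose hM := GRing.isZmodMorphism.Build B D h hB.
pose h' : {additive B -> D} := HB.pack h hM.
exists h' => b y Gby; apply: (partial_additive_fun hA (hH b)).
by right.
Qed.

Lemma additive_separation (b : B) (y : D) :
  (forall n : int, b *~ n = 0 -> y *~ n = 0) ->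
  exists h : {additive B -> D}, h b = y.
Proof.
move=> hy; have [|h hG] := @additive_extension
  [set u | exists n : int, u = (b *~ n, y *~ n)].
  split; first by exists 0.
  - by move=> _ _ [n ->] [m ->]; exists (n - m); rewrite !mulrzBr.
  - by move=> c [n [/esym/hy e ->]].
by exists h; apply: hG; exists 1.
Qed.

End Divisible.

Definition integral_rat : {pred rat} := fun x => x \is a Num.int.

Lemma integral_rat_closed : zmod_closed integral_rat.
Proof. by split=> [|x y]; rewrite !unfold_in; [exact: rpred0 | exact: rpredB]. Qed.

HB.instance Definition _ :=
  GRing.isZmodClosed.Build rat integral_rat integral_rat_closed.

Definition QmodZ := Quotient.quot integral_rat.

HB.instance Definition _ := GRing.Zmodule.on QmodZ.

Definition toQmodZ (x : rat) : QmodZ := \pi_(Quotient.quot integral_rat) x.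

Lemma toQmodZ_muln x n : toQmodZ x *+ n = toQmodZ (x *+ n).
Proof. by rewrite /toQmodZ [RHS]raddfMn. Qed.

Lemma toQmodZ_eq0 x : toQmodZ x = 0 <-> x \is a Num.int.
Proof.
have -> : 0 = toQmodZ 0 by rewrite /toQmodZ [RHS]raddf0.
rewrite -{2}[x]subr0 -[_ \is a _]/(x - 0 \in integral_rat).
by rewrite Quotient.idealrBE; split=> [/eqP|h]; last exact/eqP.
Qed.

Lemma QmodZ_divisible n (y : QmodZ) : (0 < n)%N -> exists z, z *+ n = y.
Proof.
move=> n0; rewrite -[y]reprK; exists (toQmodZ (repr y / n%:R)).
by rewrite toQmodZ_muln -[X in toQmodZ X]mulr_natr divfK ?pnatr_eq0 -?lt0n.
Qed.

Lemma QmodZ_separation (B : zmodType) (b : B) : b != 0 ->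
  exists h : {additive B -> QmodZ}, h b != 0.
Proof.
move=> b0.
pose S n := `[< (0 < n)%N /\ b *+ n = 0 >].
suff [y y0 hy] : exists2 y : QmodZ, y != 0 & forall n, S n -> y *+ n = 0.
  have [|h hb] := additive_separation QmodZ_divisible (b := b) (y := y).
    have E (n : nat) : b *+ n = 0 -> y *+ n = 0.
      by case: n => // n bn; apply: hy; apply/asboolP.
    case=> n; first exact: E.
    rewrite NegzE !mulrNz -!pmulrn => /eqP; rewrite oppr_eq0 => /eqP/E ->.
    by rewrite oppr0.
  by exists h; rewrite hb.
have [[n0 Sn0]|noS] := pselect (exists n, S n); last first.
  exists (toQmodZ 2^-1) => [|n Sn]; last by case: noS; exists n.
  by apply/eqP => /toQmodZ_eq0.
have exS : exists n, S n by exists n0.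
case: (ex_minnP exS) => m /asboolP[m0 bm] min.
have m1 : (1 < m)%N.
  by case: m m0 bm {min} => [|[|m]] //= _; rewrite mulr1n => /eqP; rewrite (negPf b0).
exists (toQmodZ m%:R^-1) => [|n /asboolP[n0' bn]].
  apply/eqP => /toQmodZ_eq0/norm_intr_ge1.
  rewrite invr_eq0 pnatr_eq0 -lt0n m0 => /(_ isT).
  rewrite ger0_norm ?invr_ge0 ?ler0n // invr_ge1 ?ltr0n ?unitfE ?pnatr_eq0 -?lt0n //.
  by rewrite lern1 leqNgt m1.
rewrite toQmodZ_muln; apply/toQmodZ_eq0.
have /dvdnP[q ->] : (m %| n)%N.
  have e : b *+ (n %% m) = 0.
    by rewrite {1}(divn_eq n m) mulrnDr mulnC mulrnA bm mul0rn add0r in bn.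
  rewrite /dvdn; case: (posnP (n %% m)%N) => [//|r0].
  have /min : S (n %% m)%N by apply/asboolP.
  by rewrite leqNgt ltn_pmod.
by rewrite -[X in X \is a _]mulr_natr mulrC natrM mulfK ?pnatr_eq0 -?lt0n.
Qed.

Section InjectiveHull.
Variables (R : comPzRingType) (T : Type).

(* The module of additive maps from [R] to the product of [T] copies of Q/Z. *)
Definition coinduced_pred : {pred T -> R -> QmodZ} :=
  fun phi => `[< forall t, zmod_morphism (phi t) >].

Lemma coinduced_closed : zmod_closed coinduced_pred.
Proof.
split=> [|phi psi]; first by apply/asboolP => t r s; rewrite /= subr0.
move=> /asboolP hphi /asboolP hpsi; apply/asboolP => t r s.
rewrite -![(phi - psi) _ _]/(phi _ _ - psi _ _) hphi hpsi.
by rewrite !opprD !opprK addrACA.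
Qed.

HB.instance Definition _ :=
  GRing.isZmodClosed.Build (T -> R -> QmodZ) coinduced_pred coinduced_closed.

Definition coinduced := {phi : T -> R -> QmodZ | phi \in coinduced_pred}.

HB.instance Definition _ := SubType.on coinduced.
HB.instance Definition _ := Choice.on coinduced.
HB.instance Definition _ := [SubChoice_isSubZmodule of coinduced by <:].

Lemma coinducedB (phi : coinduced) t : zmod_morphism (val phi t).
Proof. by have /asboolP := valP phi; apply. Qed.

Lemma coinducedD (phi : coinduced) t : {morph val phi t : r s / r + s}.
Proof.
move=> r s; have h0 : val phi t 0 = 0.
  by rewrite -(subrr 0) coinducedB subrr.
by rewrite -{1}[s]opprK -[- s]add0r !coinducedB h0 sub0r opprK.
Qed.

Lemma coinduced_scale_subproof (a : R) (phi : coinduced) :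
  (fun t r => val phi t (r * a)) \in coinduced_pred.
Proof. by apply/asboolP => t r s; rewrite mulrBl coinducedB. Qed.

Definition coinduced_scale (a : R) (phi : coinduced) : coinduced :=
  exist (fun phi => phi \in coinduced_pred) _ (coinduced_scale_subproof a phi).

Lemma coinduced_eq (phi psi : coinduced) :
  (forall t r, val phi t r = val psi t r) -> phi = psi.
Proof. by move=> h; apply/val_inj/funext => t; apply/funext => r. Qed.

Lemma coinduced_scaleA a b phi :
  coinduced_scale a (coinduced_scale b phi) = coinduced_scale (a * b) phi.
Proof. by apply: coinduced_eq => t r /=; rewrite mulrA. Qed.

Lemma coinduced_scale1 : left_id 1 coinduced_scale.
Proof. by move=> phi; apply: coinduced_eq => t r /=; rewrite mulr1. Qed.

Lemma coinduced_scaleDr : right_distributive coinduced_scale +%R.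
Proof. by move=> a phi psi; apply: coinduced_eq. Qed.

Lemma coinduced_scaleDl phi : {morph coinduced_scale^~ phi : a b / a + b}.
Proof.
move=> a b; apply: coinduced_eq => t r /=.
by rewrite mulrDr coinducedD.
Qed.

HB.instance Definition _ := GRing.Zmodule_isLmodule.Build R coinduced
  coinduced_scaleA coinduced_scale1 coinduced_scaleDr coinduced_scaleDl.

Lemma coinduced_injective : injective_module (coinduced : lmodType R).
Proof.
move=> A B i g i_inj.
have ext t : exists h : {additive B -> QmodZ}, forall a, h (i a) = val (g a) t 1.
  have [|h hG] := additive_extension QmodZ_divisible
    (G := [set u | exists a, u = (i a, val (g a) t 1)]).
    split; first by exists 0; rewrite !linear0.
    - by move=> _ _ [a ->] [b ->]; exists (a - b); rewrite !linearB.
    - by move=> y [a [/esym/eqP]]; rewrite -{1}(linear0 i) => /eqP/i_inj -> ->;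
        rewrite linear0.
  by exists h => a; apply: hG; exists a.
have [h hE] := choice ext.
have hP (b : B) : (fun t r => h t (r *: b)) \in coinduced_pred.
  by apply/asboolP => t r s; rewrite scalerBl raddfB.
pose H (b : B) : coinduced := exist (fun phi => phi \in coinduced_pred) _ (hP b).
have Hlin : linear H.
  move=> a b c; apply: coinduced_eq => t r /=.
  by rewrite scalerDr raddfD scalerA.
pose Hm := GRing.isLinear.Build R B coinduced _ H Hlin.
pose H' : {linear B -> coinduced} := HB.pack H Hm.
exists H' => a; apply: coinduced_eq => t r /=.
rewrite -linearZ hE linearZ /=.
by rewrite mul1r.
Qed.

End InjectiveHull.

Section CanonicalResolution.
Variable R : comPzRingType.

Definition hull (M : lmodType R) : lmodType R :=
  coinduced R {additive M -> QmodZ}.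

Lemma hull_in_subproof (M : lmodType R) (x : M) :
  (fun (chi : {additive M -> QmodZ}) (r : R) => chi (r *: x)) \in
    @coinduced_pred R {additive M -> QmodZ}.
Proof. by apply/asboolP => t r s; rewrite scalerBl raddfB. Qed.

Definition hull_in (M : lmodType R) (x : M) : hull M :=
  exist (fun phi => phi \in @coinduced_pred R _) _ (hull_in_subproof x).

Lemma hull_in_is_linear (M : lmodType R) : linear (@hull_in M).
Proof.
move=> a x y; apply: coinduced_eq => chi r /=.
by rewrite scalerDr raddfD scalerA.
Qed.

HB.instance Definition _ (M : lmodType R) :=
  GRing.isLinear.Build R M (hull M) _ (@hull_in M) (@hull_in_is_linear M).

Lemma hull_in_inj (M : lmodType R) : injective (@hull_in M).
Proof.
move=> x y e; apply/eqP; rewrite -subr_eq0; apply: contraT => /QmodZ_separation.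
move=> [chi /negP[]]; rewrite raddfB subr_eq0.
have := congr1 (fun phi : hull M => val phi chi 1) e.
by rewrite /= !scale1r => ->.
Qed.

Definition hull_range (M : lmodType R) : {pred hull M} :=
  fun x => `[< range (@hull_in M) x >].

Lemma hull_range_closed (M : lmodType R) : GRing.submod_closed (@hull_range M).
Proof.
split=> [|a _ _ /asboolP[x _ <-] /asboolP[y _ <-]]; apply/asboolP.
  by exists 0; rewrite // linear0.
by exists (a *: x + y); rewrite // linearP.
Qed.

HB.instance Definition _ (M : lmodType R) :=
  GRing.isSubmodClosed.Build R (hull M) (@hull_range M) (@hull_range_closed M).

Fixpoint cosyzygy (M : lmodType R) (n : nat) : lmodType R :=
  if n is n'.+1 then quotient_module (@hull_range (cosyzygy M n')) else M.

Definition canonical_diff (M : lmodType R) (n : nat) :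
    {linear hull (cosyzygy M n) -> hull (cosyzygy M n.+1)} :=
  (@hull_in (cosyzygy M n.+1)) \o (@quo _ _ (@hull_range (cosyzygy M n))).

Lemma canonical_diff_eq0 (M : lmodType R) n x :
  canonical_diff M n x = 0 <-> range (@hull_in (cosyzygy M n)) x.
Proof.
rewrite /canonical_diff /=; split=> [h|h].
  have : quo (@hull_range (cosyzygy M n)) x = quo _ 0.
    by rewrite linear0; apply: hull_in_inj; rewrite h linear0.
  by move=> /quoE; rewrite subr0 => /asboolP.
suff -> : quo (@hull_range (cosyzygy M n)) x = 0 by rewrite linear0.
rewrite -(linear0 (@quo _ _ (@hull_range (cosyzygy M n)))); apply/quoE.
by rewrite subr0; apply/asboolP.
Qed.

Lemma canonical_exactS (M : lmodType R) n x :
  canonical_diff M n.+1 x = 0 <-> range (canonical_diff M n) x.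
Proof.
rewrite canonical_diff_eq0; split=> -[y _ <-]; last by exists (quo _ y).
by elim/quo_ind: y => y; exists y.
Qed.

Definition canonical_resolution (M : lmodType R) : injective_resolution M :=
  @InjectiveResolution R M (fun n => hull (cosyzygy M n)) (canonical_diff M)
    (@hull_in M) (fun n => @coinduced_injective R _) (@hull_in_inj M)
    (@canonical_diff_eq0 M 0) (@canonical_exactS M).

End CanonicalResolution.

Section LocalCohomology.
Variables (R : comPzRingType) (I : set R) (i : nat) (M : lmodType R).

Definition local_cohomology_of (E : injective_resolution M) : lmodType R :=
  cohomology (fun n => Gamma_map I (res_diff E n)) i.

(* The [i]-th right derived functor of [Gamma I]. *)
Definition local_cohomology : lmodType R :=
  local_cohomology_of (canonical_resolution M).

End LocalCohomology.

(* Main.v *)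
Require Import Defs.
From HB Require Import structures.
From mathcomp Require Import all_boot all_order all_algebra.
From mathcomp Require Import all_classical ring.

Set Implicit Arguments.
Unset Strict Implicit.
Unset Printing Implicit Defensive.

Import Order.TTheory GRing.Theory Num.Theory.
Local Open Scope classical_set_scope.
Local Open Scope ring_scope.

(* Let Q be the top of a chain of primes of maximal length, generated by
   non-units a_1, ..., a_n. A prime other than Q avoids some a_i, and the
   associated primes of M avoiding a_i are associated to M_{a_i}; hence
   Ass M is contained in {Q} together with the finite sets Ass M_{a_i}.
   For local cohomology it remains to see that a prime of Ass H^i_I(R) avoiding
   f lies in Ass H^i_I(R_f). Let E and C be injective resolutions of R and R_f.
   As R is Noetherian, E_f consists of injective modules, so there are chain maps
   E -> C -> E_f whose composite is homotopic to the localization map. A cocycle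
   of Gamma_I(E) whose image in C becomes a coboundary of Gamma_I(C) is thus a
   coboundary of Gamma_I(E_f) = Gamma_I(E)_f, i.e. it is a coboundary after
   multiplication by a power of f. *)

(* [frac] alone would be the fraction-field construction of MathComp. *)
Local Notation frac := Defs.frac.

(** * Extension of linear maps and Baer's criterion *)

Section LinearGraph.
Variables (R : comPzRingType) (B D : lmodType R).

(** A linear map on a submodule of [B], encoded by its graph so that extension becomes inclusion of
    sets; the last condition is single-valuedness. *)
Definition partial_linear (G : set (B * D)) : Prop :=
  [/\ G 0, forall a u v, G u -> G v -> G (a *: u + v) & forall y, G (0, y) -> y = 0].

Lemma partial_linear_fun G b y z :
  partial_linear G -> G (b, y) -> G (b, z) -> y = z.
Proof.
case=> G0 GL Gf Gy Gz; apply/subr0_eq/Gf.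
have := GL (-1) _ _ Gz Gy; rewrite -[_ + _]/(-1 *: b + b, -1 *: z + y).
by rewrite !scaleN1r addNr addrC.
Qed.

Section GraphModule.
Variables (G : set (B * D)) (hG : partial_linear G).

(** The proof is an argument so that the submodule instance can be inferred from the predicate
    alone. *)
Definition graph_pred of partial_linear G : {pred B * D} := fun u => `[< G u >].

Lemma graph_pred_closed : GRing.submod_closed (graph_pred hG).
Proof.
have [G0 GL _] := hG; split=> [|a u v]; first exact/asboolP.
by move=> /asboolP Gu /asboolP Gv; apply/asboolP; exact: GL.
Qed.

HB.instance Definition _ :=
  GRing.isSubmodClosed.Build R (B * D)%type (graph_pred hG) graph_pred_closed.

Definition graph_module := {u : B * D | u \in graph_pred hG}.

HB.instance Definition _ := SubType.on graph_module.
HB.instance Definition _ := Choice.on graph_module.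
HB.instance Definition _ := [SubChoice_isSubLmodule of graph_module by <:].

End GraphModule.

(** The first projection embeds the graph, seen as a module, into [B]; the second projection is then
    extended along it. *)
Lemma injective_graph_extension G : injective_module D -> partial_linear G ->
  exists h : {linear B -> D}, forall b y, G (b, y) -> h b = y.
Proof.
move=> injD hG.
pose p (u : graph_module hG) : B := (val u).1.
pose q (u : graph_module hG) : D := (val u).2.
have pL : linear p by [].
have qL : linear q by [].
pose p' : {linear graph_module hG -> B} :=
  HB.pack p (GRing.isLinear.Build R (graph_module hG) B _ p pL).
pose q' : {linear graph_module hG -> D} :=
  HB.pack q (GRing.isLinear.Build R (graph_module hG) D _ q qL).
have [|h hE] := injD _ _ p' q'.
  move=> [[b y] Gy] [[c z] Gz] bc; apply: val_inj; rewrite /=.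
  have {}bc : b = c := bc; subst c.
  by congr pair; apply: (partial_linear_fun hG); apply/asboolP; [exact: Gy | exact: Gz].
exists h => b y Gby.
by have /= := hE (exist _ (b, y) (introT (asboolP _) Gby)).
Qed.

(** Adjoins [b] to the domain with value [z]; [z] agrees with [G] on the multiples of [b] already
    there, so the result is single-valued. *)
Lemma partial_linear_extend G b z : partial_linear G ->
  (forall r y, G (r *: b, y) -> y = r *: z) ->
  partial_linear [set u | exists v r, G v /\ u = v + (r *: b, r *: z)].
Proof.
move=> [G0 GL Gf] hz; split.
- by exists 0, 0; split=> //; rewrite !scale0r addr0.
- move=> a _ _ [u [r [Gu ->]]] [v [s [Gv ->]]].
  exists (a *: u + v), (a * r + s); split; first exact: GL.
  rewrite scalerDr addrACA -[_ *: (_, _)]/(a *: (r *: b), a *: (r *: z)).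
  by rewrite !scalerDl !scalerA.
- move=> y [[c w] [r [Gv [/esym/eqP]]]]; rewrite addr_eq0 => /eqP ec ->.
  have := hz (- r) w; rewrite scaleNr -ec => /(_ Gv) ->.
  by rewrite scaleNr addNr.
Qed.

End LinearGraph.

Lemma baer (R : comPzRingType) (D : lmodType R) :
  (forall G : set (R^o * D), partial_linear G ->
     exists z, forall r y, G (r, y) -> y = r *: z) ->
  injective_module D.
Proof.
move=> baerD A B i g i_inj.
pose G : set (B * D) := [set u | exists a, u = (i a, g a)].
have hG : partial_linear G.
  split; first by exists 0; rewrite !linear0.
  - by move=> a _ _ [u ->] [v ->]; exists (a *: u + v); rewrite !linearP.
  - by move=> y [a [/esym/eqP]]; rewrite -{1}(linear0 i) => /eqP/i_inj -> ->;
      rewrite linear0.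
(* Taking the union with [G] inside the predicate lets the empty chain satisfy the hypothesis of
   Zorn's lemma. *)
have [F FP Ftot|K [hK Kmax]] :=
  @Zorn_bigcup _ (fun X => partial_linear (X `|` G)).
  pose U := \bigcup_(X in F) X `|` G.
  have sub u v : U u -> U v ->
      exists H, [/\ partial_linear H, H `<=` U, H u & H v].
    have FU X : F X -> X `|` G `<=` U.
      by move=> FX w [Xw|Gw]; [left; exists X | right].
    move=> [[X FX Xu]|Gu] [[Y FY Yv]|Gv].
    - have [XY|YX] := Ftot X Y FX FY.
        by exists (Y `|` G); split; [exact: FP|exact: FU|left; exact: XY|left].
      by exists (X `|` G); split; [exact: FP|exact: FU|left|left; exact: YX].
    - by exists (X `|` G); split; [exact: FP|exact: FU|left|right].
    - by exists (Y `|` G); split; [exact: FP|exact: FU|right|left].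
    - by exists G; split=> // w Gw; right.
  split; first by right; case: hG.
  - by move=> a u v /sub/[apply] -[H [[_ HL _] HU Hu Hv]]; exact/HU/HL.
  - by move=> y Uy; have [H [[_ _ Hf] _ Hy _]] := sub _ _ Uy Uy; exact: Hf.
set H := K `|` G in hK.
have tot b : exists y, H (b, y).
  apply: contrapT => nHb.
  (* The scalars carrying [b] into the domain of [H] form an ideal; the map on this ideal supplies
     the value [z] for [b]. *)
  have [|z hz] := baerD [set u | H (u.1 *: b, u.2)].
    case: hK => H0 HL Hf; split.
    - by rewrite /= scale0r.
    - move=> a [r x] [s y] /= Hr Hs; have := HL a _ _ Hr Hs.
      by rewrite -[a *: _ + _]/(a *: (r *: b) + s *: b, _) scalerA -scalerDl.
    - by move=> y /=; rewrite scale0r; exact: Hf.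
  have hH' := partial_linear_extend hK hz.
  set H' := [set u | _] in hH'.
  have HH' : H `<=` H' by move=> u Hu; exists u, 0; rewrite !scale0r addr0.
  apply: (Kmax H'); last first.
    by rewrite (_ : H' `|` G = H') //; apply: setUidl => u Gu; apply: HH'; right.
  split=> [u Ku|H'K]; first by apply: HH'; left.
  apply: nHb; exists z; left; apply: H'K.
  by exists 0, 1; split; [case: hK | rewrite !scale1r add0r].
have [h hH] := choice tot.
have hL : linear h.
  move=> a b c; apply: (partial_linear_fun hK (hH _)).
  by case: hK => _ HL _; exact: (HL a (b, h b) (c, h c)).
pose h' : {linear B -> D} := HB.pack h (GRing.isLinear.Build R B D _ h hL).
exists h' => a.
by apply: (partial_linear_fun hK (hH _)); right; exists a.
Qed.

Lemma injective_factor (R : comPzRingType) (A B D : lmodType R)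
    (d : {linear A -> B}) (u : {linear A -> D}) :
  injective_module D -> (forall x, d x = 0 -> u x = 0) ->
  exists v : {linear B -> D}, forall x, v (d x) = u x.
Proof.
move=> injD du.
have [|v hv] := injective_graph_extension
    (G := [set w | exists x, w = (d x, u x)]) injD.
  split; first by exists 0; rewrite !linear0.
  - by move=> a _ _ [x ->] [y ->]; exists (a *: x + y); rewrite !linearP.
  - by move=> y [x [/esym/du ux ->]].
by exists v => x; apply: hv; exists x.
Qed.

(** Dependent choice in a family of types; the invariant [Q] holds what the next step needs. *)
Lemma dependent_sequence (T : nat -> Type) (Q : forall n, T n -> Prop)
    (P : forall n, T n -> T n.+1 -> Prop) (t0 : T 0%N) :
  Q 0%N t0 -> (forall n t, Q n t -> exists2 t', P n t t' & Q n.+1 t') ->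
  exists2 t : forall n, T n, t 0%N = t0 & forall n, P n (t n) (t n.+1).
Proof.
move=> Q0 step.
have step' n (t : {t : T n | Q n t}) :
    {t' : {t' : T n.+1 | Q n.+1 t'} | P n (sval t) (sval t')}.
  apply: cid; case: t => t Qt; have [t' Pt Qt'] := step n t Qt.
  by exists (exist _ t' Qt').
pose s := nat_rect (fun n => {t : T n | Q n t}) (exist _ t0 Q0)
  (fun n t => sval (step' n t)).
by exists (fun n => sval (s n)) => // n; exact: (svalP (step' n (s n))).
Qed.

(** * Chain maps and homotopies into complexes of injectives *)

Section Comparison.
Variable R : comPzRingType.
Variables (X Y : nat -> lmodType R).
Variable dX : forall n, {linear X n -> X n.+1}.
Variable dY : forall n, {linear Y n -> Y n.+1}.
Hypothesis X_exact0 : forall x, dX 0 x = 0 -> x = 0.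
Hypothesis X_exactS : forall n x, dX n.+1 x = 0 -> exists z, x = dX n z.
Hypothesis Y_complex : forall n y, dY n.+1 (dY n y) = 0.
Hypothesis Y_injective : forall n, injective_module (Y n.+1).

(** By exactness of [X], [dY n \o t n] kills the kernel of [dX n], so it factors through [dX n]. *)
Lemma chain_map_extension (g : {linear X 0%N -> Y 0%N}) :
  exists2 t : forall n, {linear X n -> Y n},
    t 0%N = g & forall n x, t n.+1 (dX n x) = dY n (t n x).
Proof.
apply: (@dependent_sequence (fun n => {linear X n -> Y n})
  (fun n t => forall x, dX n x = 0 -> dY n (t x) = 0)
  (fun n t t' => forall x, t' (dX n x) = dY n (t x))).
  by move=> x /X_exact0 ->; rewrite !linear0.
move=> n t ht.
have [t' ht'] := injective_factor (u := dY n \o t) (@Y_injective n) ht.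
by exists t' => // x /X_exactS[z ->]; rewrite ht' /= Y_complex.
Qed.

(** The map [h n.+1 - dY n \o s n] kills the kernel of [dX n.+1], hence factors through it. The
    start [s 0 = 0] is possible since [h] vanishes in degree 0. *)
Lemma null_homotopy (h : forall n, {linear X n -> Y n}) :
  (forall x, h 0%N x = 0) -> (forall n x, h n.+1 (dX n x) = dY n (h n x)) ->
  exists2 s : forall n, {linear X n.+1 -> Y n},
    s 0%N = \0 & forall n x, h n.+1 x = s n.+1 (dX n.+1 x) + dY n (s n x).
Proof.
move=> h0 hd.
apply: (@dependent_sequence (fun n => {linear X n.+1 -> Y n})
  (fun n s => forall x, dX n.+1 x = 0 -> h n.+1 x = dY n (s x))
  (fun n s s' => forall x, h n.+1 x = s' (dX n.+1 x) + dY n (s x))).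
  by move=> x /X_exactS[z ->]; rewrite hd h0 !linear0.
move=> n s hs.
have [|s' hs'] := injective_factor (d := dX n.+1)
    (u := h n.+1 \- (dY n \o s)) (@Y_injective n).
  by move=> x /hs /= ->; rewrite subrr.
exists s' => [x|x /X_exactS[z ->]]; first by rewrite hs' /= subrK.
by rewrite hs' /= linearB Y_complex subr0 hd.
Qed.

End Comparison.

(** * Ideals and their generators *)

Section Ideals.
Variable R : comPzRingType.

Lemma ideal_span_is_ideal n (a : 'I_n -> R) : is_ideal (ideal_span a).
Proof.
split.
- by exists (fun=> 0); rewrite big1 // => i _; rewrite mul0r.
- move=> _ _ [r ->] [s ->]; exists (fun i => r i + s i).
  by rewrite -big_split; apply: eq_bigr => i _; rewrite mulrDl.
- move=> c _ [r ->]; exists (fun i => c * r i).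
  by rewrite mulr_sumr; apply: eq_bigr => i _; rewrite mulrA.
Qed.

Lemma ideal_span_gen n (a : 'I_n -> R) i : ideal_span a (a i).
Proof.
exists (fun j => (j == i)%:R); rewrite (bigD1 i) //= eqxx mul1r big1 ?addr0 //.
by move=> j /negPf ->; rewrite mul0r.
Qed.

Lemma ideal_pow_is_ideal (I : set R) n : is_ideal (ideal_pow I n).
Proof.
by split=> [|x y|a x]; [exact: ideal_pow0|exact: ideal_pow_add|exact: ideal_pow_mulr].
Qed.

Lemma prime_ideal_pow (P : set R) f k : prime_ideal P -> P (f ^+ k) -> P f.
Proof.
case=> _ P1 Pmul; elim: k => [//|k IHk].
by rewrite exprS => /Pmul[].
Qed.

(** The sum of exponents serving finitely many generators serves all of [J]. *)
Lemma uniform_power (M : lmodType R) (J : set R) (f : R) (m : M) :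
  noetherian R -> is_ideal J ->
  (forall a, J a -> exists k, (f ^+ k * a) *: m = 0) ->
  exists k, forall a, J a -> (f ^+ k * a) *: m = 0.
Proof.
move=> noeth /noeth[n [a ->]] h.
have /choice[k hk] i : exists k, (f ^+ k * a i) *: m = 0.
  by apply: h; exact: ideal_span_gen.
exists (\sum_i k i)%N => _ [r ->].
rewrite mulr_sumr scaler_suml big1 // => i _.
rewrite (bigD1 i) //= exprD; set q := f ^+ (\sum_(_ | _) _).
rewrite (_ : _ * _ = r i * q * (f ^+ k i * a i)); last by ring.
by rewrite -scalerA hk scaler0.
Qed.

End Ideals.

(** * Localization preserves injectivity over a Noetherian ring *)

Section LocalizationTheory.
Variables (R : comPzRingType) (f : R).

Section Fractions.
Variable M : lmodType R.
Implicit Types (m n : M).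

Lemma frac_eq0 m a : frac f m a = 0 <-> exists k, f ^+ k *: m = 0.
Proof.
split=> [/fracP[k]|[k hk]]; first by rewrite addn0 scaler0; exists k.
by apply/fracP; exists k; rewrite addn0 hk scaler0.
Qed.

Lemma fracZ r m a : r *: frac f m a = frac f (r *: m) a.
Proof. exact: loc_scaleE. Qed.

Lemma frac_shift k m a : frac f (f ^+ k *: m) (k + a) = frac f m a.
Proof. by apply/fracP; exists 0%N; rewrite !add0n scalerA -exprD addnC. Qed.

Lemma fracD m n a : frac f m a + frac f n a = frac f (m + n) a.
Proof. by rewrite [LHS]loc_addE -scalerDr frac_shift. Qed.

Definition loc_in m : localization M f := frac f m 0.

Lemma loc_in_is_linear : linear loc_in.
Proof. by move=> r m n; rewrite /loc_in fracZ fracD. Qed.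

HB.instance Definition _ :=
  GRing.isLinear.Build R M (localization M f) _ loc_in loc_in_is_linear.

End Fractions.

Section LocalizationMap.
Variables (M N : lmodType R) (u : {linear M -> N}).

Definition loc_map (x : localization M f) : localization N f :=
  frac f (u (repr x).1) (repr x).2.

Lemma loc_mapE m a : loc_map (frac f m a) = frac f (u m) a.
Proof.
have [k e] := repr_frac f m a; apply/fracP; exists k.
by rewrite -!linearZ e.
Qed.

Lemma loc_map_is_linear : linear loc_map.
Proof.
move=> r; elim/frac_ind=> m a; elim/frac_ind=> n b.
rewrite fracZ -[frac f (r *: m) a](frac_shift b) -[frac f n b](frac_shift a).
rewrite (addnC a b) fracD !loc_mapE.
rewrite -[frac f (u m) a](frac_shift b).
by rewrite fracZ fracD linearD !linearZ /= !scalerA [_ * r]mulrC.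
Qed.

HB.instance Definition _ := GRing.isLinear.Build R (localization M f)
  (localization N f) _ loc_map loc_map_is_linear.

End LocalizationMap.

(* Adding one generator at a time requires only the colon ideals (J : a_j) to be
   finitely generated, instead of the syzygy module of all the generators. *)
Lemma localization_baer_step (E : lmodType R) :
  noetherian R -> injective_module E ->
  forall n (a : 'I_n -> R) (G : set (R^o * localization E f)), partial_linear G ->
    (forall i, exists y, G (a i, y)) ->
    exists z : localization E f,
      forall (r : R) y, G (r, y) -> ideal_span a r -> y = r *: z.
Proof.
move=> noeth injE; elim=> [|n IHn] a G hG dom; have [G0 GL Gf] := hG.
  exists 0 => r y Gry [c rE]; move: Gry; rewrite rE big_ord0 => /Gf ->.
  by rewrite scaler0.
have [i|z hz] := IHn (fun i => a (lift ord0 i)) G hG; first exact: dom.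
set J := ideal_span _ in hz.
have [J0 JD JM] : is_ideal J := ideal_span_is_ideal _.
have [y0 Gy0] := dom ord0; set a0 := a ord0 in Gy0.
have [m [c wE]] : exists m c, y0 - a0 *: z = frac f m c.
  by elim/frac_ind: (y0 - a0 *: z) => m c; exists m, c.
(* If [r * a0] lies in [J], then [r] kills the error [m / f ^+ c] of [z] at [a0]; one power of [f]
   serves the whole colon ideal. *)
have [|r Jr|k hk] := @uniform_power _ _ [set r | J (r * a0)] f m noeth.
- split=> [|r s|r s] /=; first by rewrite mul0r.
    by rewrite mulrDl; exact: JD.
  by rewrite -mulrA; exact: JM.
- have := GL r _ _ Gy0 G0; rewrite addr0 => /hz/(_ Jr) /= e.
  have /frac_eq0[k hk] : frac f (r *: m) c = 0.
    by rewrite -fracZ -wE scalerBr e scalerA subrr.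
  by exists k; rewrite -scalerA.
(* The choice of [k] makes [p + r * a0 |-> (f ^+ k * r) *: m] well defined on the ideal generated by
   [J] and [a0]. *)
have [|h hE] := @injective_graph_extension _ R^o E
    [set u | exists p r, J p /\ u = (p + r * a0, (f ^+ k * r) *: m)] injE.
  split.
  - by exists 0, 0; split=> //; rewrite mul0r mulr0 scale0r addr0.
  - move=> s _ _ [p [r [Jp ->]]] [q [t [Jq ->]]]; exists (s * p + q), (s * r + t).
    split; first by apply: JD => //; exact: JM.
    apply/pair_equal_spec; split=> /=.
      by rewrite -[s *: _]/(s * (p + r * a0)); ring.
    by rewrite scalerA -scalerDl; congr (_ *: _); ring.
  - move=> y [p [r [Jp [/esym/eqP]]]]; rewrite addr_eq0 => /eqP pE ->; apply: hk.
    by rewrite /= -[r * a0]opprK -pE -mulN1r; exact: JM.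
(* The correction is killed by [J], and [a0] takes it to the error [m / f ^+ c]. *)
exists (z + frac f (h 1) (k + c)) => r y Gry [b rE].
have [s [p [Jp {b}rE]]] : exists s p, J p /\ r = s * a0 + p.
  exists (b ord0), (\sum_(i < n) b (lift ord0 i) * a (lift ord0 i)).
  by split; [exists (fun i => b (lift ord0 i)) | rewrite rE big_ord_recl].
have yE : y - s *: y0 = p *: z.
  apply: hz => //; have := GL (- s) _ _ Gy0 Gry.
  rewrite -[_ + _]/(- s * a0 + r, - s *: y0 + y) rE mulNr addKr.
  by rewrite scaleNr addrC.
have hr : r *: h 1 = (f ^+ k * s) *: m.
  rewrite -linearZ; apply: hE; exists p, s; split=> //.
  by congr pair; rewrite [LHS]mulr1 rE addrC.
rewrite scalerDr fracZ hr -scalerA frac_shift -fracZ -wE scalerBr scalerA.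
by rewrite {1}rE scalerDl -yE [RHS]addrC addrA subrK addrC subrK.
Qed.

(** By Baer's criterion only maps on ideals matter, and these ideals are finitely generated. *)
Lemma localization_injective (E : lmodType R) : noetherian R ->
  injective_module E -> injective_module (localization E f).
Proof.
move=> noeth injE; apply: baer => G hG; have [G0 GL Gf] := hG.
have [|n [a JE]] := noeth [set r | exists y, G (r, y)].
  split; first by exists 0.
  - move=> r s [y Gy] [z Gz]; exists (1 *: y + z).
    by have := GL 1 _ _ Gy Gz; rewrite -[_ + _]/(1 * r + s, _) mul1r.
  - move=> r s [y Gy]; exists (r *: y).
    by have := GL r _ _ Gy G0; rewrite addr0.
have [i|z hz] := localization_baer_step noeth injE (a := a) hG.
  suff : [set r | exists y, G (r, y)] (a i) by [].
  by rewrite JE; exact: ideal_span_gen.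
exists z => r y Gry; apply: hz => //.
by rewrite -JE; exists y.
Qed.

End LocalizationTheory.

(** * Resolutions with the module placed in degree 0 *)

Section AugmentedResolution.
Variables (R : comPzRingType) (M : lmodType R) (E : injective_resolution M).

Definition aug_obj (n : nat) : lmodType R :=
  if n is n'.+1 then res_obj E n' else M.

Definition aug_diff (n : nat) : {linear aug_obj n -> aug_obj n.+1} :=
  if n is n'.+1 return {linear aug_obj n -> aug_obj n.+1} then res_diff E n'
  else res_aug E.

Lemma aug_exact0 x : aug_diff 0 x = 0 -> x = 0.
Proof. by rewrite -(linear0 (aug_diff 0)) => /(@res_aug_inj _ _ E). Qed.

Lemma aug_exactS n x : aug_diff n.+1 x = 0 -> exists z, x = aug_diff n z.
Proof.
by case: n x => [|n] x; [move=> /res_exact0|move=> /res_exactS]; case=> z _ <-; exists z.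
Qed.

Lemma aug_complex n x : aug_diff n.+1 (aug_diff n x) = 0.
Proof. by case: n x => [|n] x; [apply/res_exact0|apply/res_exactS]; exists x. Qed.

Lemma aug_injective n : injective_module (aug_obj n.+1).
Proof. exact: res_injective. Qed.

End AugmentedResolution.

(** * Associated primes of localizations and of local cohomology *)

Section AssociatedPrimes.
Variable R : comPzRingType.

(** If [P] annihilates exactly [m], it is also the annihilator of [m / 1], because no power of [f]
    lies in [P]. *)
Lemma Ass_localization (M : lmodType R) (f : R) (P : set R) :
  Ass M P -> ~ P f -> Ass (localization M f) P.
Proof.
move=> [Pprime [m PE]] nPf; split=> //; exists (loc_in f m).
apply/seteqP; split=> a /=.
  by move=> Pa; rewrite -linearZ /= (_ : a *: m = 0) ?linear0 //; move: Pa; rewrite PE.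
rewrite /loc_in fracZ => /frac_eq0[k]; rewrite scalerA => e.
have : P (f ^+ k * a) by rewrite PE.
by case: (Pprime) => _ _ Pmul /Pmul[/(prime_ideal_pow Pprime)/nPf|].
Qed.

Lemma Ass_cohomology (C : nat -> lmodType R) (d : forall n, {linear C n -> C n.+1})
    (n : nat) (P : set R) :
  Ass (cohomology d n) P <-> prime_ideal P /\
    exists x, d n x = 0 /\ P = [set a | coboundary d (a *: x)].
Proof.
have annE (z : cocycles d n) :
    [set a | a *: quo (@coboundary_in R C d n) z = 0] =
    [set a | coboundary d (a *: val z)].
  apply/seteqP; split=> a /=.
    rewrite -linearZ -(linear0 (quo (@coboundary_in R C d n))) => /quoE.
    by rewrite subr0 => /asboolP.
  move=> h; rewrite -linearZ -(linear0 (quo (@coboundary_in R C d n))).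
  by apply/quoE; rewrite subr0; exact/asboolP.
split=> [[Pprime [y PE]]|[Pprime [x [dx PE]]]]; split=> //.
  elim/quo_ind: y PE => z ->; exists (val z); split; last exact: annE.
  by have /eqP := valP (z : cocycles d n).
have zx : x \in @cocycle R C d n by apply/eqP.
by exists (quo (@coboundary_in R C d n) (exist _ x zx)); rewrite PE annE.
Qed.

(* The coboundaries are described in the augmented complex, where the degree
   is shifted by one; this absorbs the case [i = 0]. *)
Lemma Ass_local_cohomology (I : set R) (i : nat) (M : lmodType R)
    (E : injective_resolution M) (P : set R) :
  Ass (local_cohomology_of I i E) P <-> prime_ideal P /\
    exists x : aug_obj E i.+1, [/\ x \in @torsion R I _, aug_diff E i.+1 x = 0 &
      P = [set a | exists y : aug_obj E i, [/\ (0 < i)%N \/ y = 0,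
             y \in @torsion R I _ & a *: x = aug_diff E i y]]].
Proof.
have cobE (x : Gamma I (res_obj E i)) a :
    coboundary (fun n => Gamma_map I (res_diff E n)) (a *: x) <->
    exists y : aug_obj E i, [/\ (0 < i)%N \/ y = 0, y \in @torsion R I _ &
      a *: val x = aug_diff E i y].
  case: i x => [|i] x /=; split.
  - move=> ax; exists 0; rewrite rpred0 linear0; split=> //; first by right.
    exact: (congr1 val ax).
  - by move=> [y [[//|->] _]]; rewrite linear0 => ax; apply: val_inj.
  - by move=> [y _ e]; exists (val y); split; [left|exact: valP|exact/esym/(congr1 val e)].
  - by move=> [y [_ ty e]]; exists (exist _ y ty) => //; apply: val_inj.
split=> [/Ass_cohomology[Pprime [x [dx PE]]]|[Pprime [x [tx dx PE]]]].
  split=> //; exists (val x); split; first exact: valP.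
    by rewrite -[LHS]/(val (Gamma_map I (res_diff E i) x)) dx.
  by rewrite PE; apply/seteqP; split=> a; case: (cobE x a).
apply/Ass_cohomology; split=> //; exists (exist _ x tx); split; first exact: val_inj.
by rewrite PE; apply/seteqP; split=> a; case: (cobE (exist _ x tx) a).
Qed.

Lemma torsion_linear (I : set R) (M N : lmodType R) (u : {linear M -> N}) x :
  x \in @torsion R I M -> u x \in @torsion R I N.
Proof. by move=> tx; exact: (Gamma_map_subproof u (exist _ x tx)). Qed.

(** As [I ^ n] is finitely generated, a single power of [f] moves [m] into the torsion of [M]. *)
Lemma torsion_localization (I : set R) (M : lmodType R) (f : R)
    (x : localization M f) : noetherian R -> x \in @torsion R I _ ->
  exists m c, m \in @torsion R I M /\ x = frac f m c.
Proof.
move=> noeth; elim/frac_ind: x => m c /asboolP[n hn].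
have [|k hk] := @uniform_power _ _ _ f m noeth (ideal_pow_is_ideal I n).
  move=> a /hn; rewrite fracZ => /frac_eq0[k e].
  by exists k; rewrite -scalerA.
exists (f ^+ k *: m), (k + c)%N; rewrite frac_shift; split=> //.
by apply/asboolP; exists n => a Ia; rewrite scalerA mulrC hk.
Qed.

(* Injectivity of H^i_I(M)_f -> H^i_I(M_f), expressed on associated primes. *)
Lemma Ass_local_cohomology_localization (I : set R) (i : nat) (M : lmodType R)
    (f : R) (E : injective_resolution M)
    (C : injective_resolution (localization M f)) (P : set R) : noetherian R ->
  Ass (local_cohomology_of I i E) P -> ~ P f -> Ass (local_cohomology_of I i C) P.
Proof.
move=> noeth /Ass_local_cohomology[Pprime [x [tx dx PE]]] nPf.
have [theta theta0 thetad] := @chain_map_extension R (aug_obj E) (aug_obj C)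
  (aug_diff E) (aug_diff C) (@aug_exact0 _ _ E) (@aug_exactS _ _ E)
  (@aug_complex _ _ C) (@aug_injective _ _ C) (@loc_in _ f M).
pose Y n : lmodType R := localization (aug_obj E n) f.
pose dY n : {linear Y n -> Y n.+1} := @loc_map _ f _ _ (aug_diff E n).
have Y_complex n y : dY n.+1 (dY n y) = 0.
  elim/frac_ind: y => m c; rewrite /dY /= !loc_mapE aug_complex.
  by apply/frac_eq0; exists 0%N; rewrite scaler0.
have Y_inj n : injective_module (Y n.+1).
  exact: localization_injective noeth (@aug_injective _ _ E n).
(* Extending the identity makes [psi \o theta] agree with localization in degree 0. *)
have [psi psi0 psid] := @chain_map_extension R (aug_obj C) Y
  (aug_diff C) dY (@aug_exact0 _ _ C) (@aug_exactS _ _ C) Y_complex Y_inj idfun.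
have [||s s0 hs] := @null_homotopy R (aug_obj E) Y (aug_diff E) dY
    (@aug_exactS _ _ E) Y_complex Y_inj
    (fun n => (psi n \o theta n) \- @loc_in _ f (aug_obj E n)).
- by move=> z /=; rewrite psi0 theta0 /= subrr.
- move=> n z /=; rewrite thetad psid linearB /=; congr (_ - _).
  by rewrite /dY /= loc_mapE.
apply/Ass_local_cohomology; split=> //; exists (theta i.+1 x); split.
- exact: torsion_linear.
- by rewrite -thetad dx linear0.
rewrite PE; apply/seteqP; split=> a /= [y [y0 ty e]].
  exists (theta i y); split; last by rewrite -linearZ e thetad.
    by case: y0 => [|->]; [left|right; rewrite linear0].
  exact: torsion_linear.
(* On the cocycle [x] the homotopy leaves only the boundary of [s i x]. *)
have locx : loc_in f (a *: x) = dY i (psi i y - a *: s i x).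
  have e1 : dY i (psi i y) = a *: psi i.+1 (theta i.+1 x).
    by rewrite -psid -e linearZ_LR.
  have e2 : dY i (s i x) = psi i.+1 (theta i.+1 x) - loc_in f x.
    by have := hs i x; rewrite dx linear0 add0r.
  rewrite linearB [dY i (a *: _)]linearZ_LR [LHS]linearZ_LR e1 e2 -scalerBr.
  by rewrite opprB addrCA subrr addr0.
have [z [c [tz zE]]] : exists z c, z \in @torsion R I _ /\ psi i y - a *: s i x = frac f z c.
  by apply: torsion_localization => //; rewrite rpredB ?rpredZ ?torsion_linear.
(* For [i = 0] the only coboundary is 0; there [y] and [s 0] vanish, so a power of [f] kills [z]. *)
have [k hk] : exists k, (0 < i)%N \/ f ^+ k *: z = 0.
  case: (posnP i) => [i0|]; last by exists 0%N; left.
  suff /frac_eq0[k] : frac f z c = 0 by exists k; right.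
  rewrite -zE; subst i; rewrite s0 /= scaler0 subr0.
  by case: y0 => // ->; rewrite linear0.
move: locx; rewrite zE /dY /= loc_mapE => /fracP[l]; rewrite addn0 => el.
(* Clearing denominators makes a power of [f] times [a *: x] a coboundary; primality then removes
   that power. *)
have : P (f ^+ (k + (l + c)) * a).
  rewrite PE; exists (f ^+ (k + l) *: z); split.
  - by case: hk => hk; [left|right; rewrite addnC exprD -scalerA hk scaler0].
  - exact: rpredZ.
  - by rewrite linearZ /= !exprD -!scalerA -el exprD -!scalerA.
by case: (Pprime) => _ _ Pmul /Pmul[/(prime_ideal_pow Pprime)/nPf[]|]; rewrite PE.
Qed.

(** The argument on primes common to both assertions, with [S] the set of associated primes. *)
Lemma finite_primes (d : nat) (S : set (set R)) : noetherian R -> krull_dim R d ->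
  S `<=` @prime_ideal R ->
  (forall f, ~ invertible f -> finite_set [set P | S P /\ ~ P f]) -> finite_set S.
Proof.
move=> noeth dimR Sprime finS.
have [Q [Qprime Qlt]] : prime_chain R d by apply/dimR.
have [Qideal Q1 _] := Qprime d (leqnn d).
have [n [a QE]] := noeth _ Qideal.
have Qa i : Q d (a i) by rewrite QE; exact: ideal_span_gen.
apply: (@sub_finite_set _ _ ([set Q d] `|`
    \bigcup_(i in [set: 'I_n]) [set P | S P /\ ~ P (a i)])); last first.
  rewrite finite_setU; split; first exact: finite_set1.
  apply: bigcup_finite => // i _; apply: finS => -[g ag].
  by apply: Q1; rewrite -ag mulrC; case: Qideal => _ _; apply.
move=> P SP; have Pprime := Sprime _ SP.
have [Pa|/existsNP[i nPa]] := pselect (forall i, P (a i)); last by right; exists i.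
left; apply: contrapT => /= nPQ.
have QP : Q d `<=` P.
  move=> x; rewrite QE => -[r ->]; have [[P0 PD PM] _ _] := Pprime.
  by elim/big_ind: _ => // i _; exact: PM.
(* [P] would otherwise prolong the chain of maximal length. *)
have : prime_chain R d.+1.
  exists (fun j => if (j <= d)%N then Q j else P); split=> j.
    by case: ifP => // jd _; exact: Qprime.
  rewrite ltnS => jd; rewrite jd; case: ltnP => [|dj]; first exact: Qlt.
  have -> : j = d by apply/eqP; rewrite eqn_leq jd.
  by split=> // PQ; apply: nPQ; apply/seteqP.
by move=> /dimR; rewrite ltnn.
Qed.

End AssociatedPrimes.

Theorem theorem3p3 (R : comPzRingType) (d : nat)
    (R_noetherian : noetherian R) (R_dim : krull_dim R d) :
  (forall M : lmodType R,
     (forall f : R, ~ invertible f -> finite_set (Ass (localization M f))) ->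
     finite_set (Ass M)) /\
  (forall i : nat,
     (forall f : R, ~ invertible f -> forall I : set R, is_ideal I ->
        finite_set (Ass (local_cohomology I i (localization R^o f)))) ->
     forall I : set R, is_ideal I -> finite_set (Ass (local_cohomology I i R^o))).
Proof.
split=> [M finM|i finH I idI].
  apply: (finite_primes R_noetherian R_dim) => [P []//|f nf].
  apply: sub_finite_set (finM f nf) => P [AP nPf]; exact: Ass_localization.
apply: (finite_primes R_noetherian R_dim) => [P []//|f nf].
apply: sub_finite_set (finH f nf I idI) => P [AP nPf].
exact: Ass_local_cohomology_localization AP nPf.
Qed.
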